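(* Let $d,k\ge 1$ be integers and $h>0$. Let $B\subset h\mathbb Z^d$ be a (finite) rectangular grid patch, partitioned into the set $X$ of known grid points and the set $Y$ of unknown grid points. Assume that $Y$ is strictly contained in $B$, with at least $k$ grid layers between $Y$ and the boundary of $B$, so that every centered stencil of width $2k+1$ used in the functional below is fully supported in $B$. Let $B_k\subset B$ be the set of grid points at distance at least $k$ grid steps from the boundary of $B$. Given $f:X\to\mathbb R$, define $$J(u)=\sum_{\nu\in B_k}\sum_{j=1}^d\bigl(\Delta_j^{2k}u(\nu)\bigr)^2$$ over all grid functions $u:B\to\mathbb R$ satisfying $u|_X=f$. Let $v\in\mathbb R^{|Y|}$ denote the vector of unknown values of $u$ on $Y$, and let $J(v)=\|Av-b\|_2^2$ be the corresponding least-squares formulation. Assume that the only grid function $w:B\to\mathbb R$ supported on $Y$ with $$\Delta_j^{2k}w(\nu)=0\qquad\text{for all }\nu\in B_k,\ j=1,\dots,d,$$ is the zero function. Then: (i) The problem of minimizing $J$ over all grid functions $u$ on $B$ with $u|_X=f$ admits a unique solution. (ii) The normal matrix $A^TA$ is symmetric and positive definite, and the minimizer is characterized by the normal equations $A^TA\,v=A^Tb$.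
   Context: $\Delta_j^{2k}$ is the (undivided) central difference operator of order $2k$ in the $j$-th coordinate direction: $$\Delta_j^{2k}u(\nu)=\sum_{m=0}^{2k}(-1)^m\binom{2k}{m}u\bigl(\nu+(k-m)h\mathbf e_j\bigr),$$ where $\mathbf e_j$ is the $j$-th standard unit vector; for $\nu\in B_k$ all points involved lie in $B$. The matrix $A$ and vector $b$ have rows indexed by pairs $(\nu,j)$, $\nu\in B_k$, $1\le j\le d$: if $u$ equals $v$ on $Y$ and $f$ on $X$, then $(Av-b)_{(\nu,j)}=\Delta_j^{2k}u(\nu)$, i.e. $Av$ collects the contributions of the unknown values and $-b$ those of the known values. *)

(* Defs.v *)
From HB Require Import structures.
From mathcomp Require Import all_boot all_order all_algebra.
From mathcomp Require Import finmap.
From mathcomp Require Import reals.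
From mathcomp Require Import zify.

Set Implicit Arguments.
Unset Strict Implicit.
Unset Printing Implicit Defensive.

Import Order.TTheory GRing.Theory Num.Theory.

Local Open Scope fset_scope.
Local Open Scope ring_scope.

Section Grid.
Variables (R : realType) (d : nat).
Implicit Types (h : R) (B X Y : {fset 'rV[R]_d}) (x y nu : 'rV[R]_d).

Definition unitv (j : 'I_d) : 'rV[R]_d := delta_mx 0 j.

Definition is_grid_patch h B : Prop :=
  exists lo hi : 'rV[int]_d, forall x,
    x \in B <-> exists2 z : 'rV[int]_d,
      forall j, lo 0 j <= z 0 j <= hi 0 j & x = h *: map_mx intr z.

Definition gboundary h B : {fset 'rV[R]_d} :=
  [fset x in B | [exists j, (x + h *: unitv j \notin B) ||
                            (x - h *: unitv j \notin B)]].

(* Distance in grid steps, for the maximum norm. In a rectangular patch, the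
   distance to the boundary is the same as for the path metric of the grid. *)
Definition gdist h x y : R := \big[Num.max/0]_(j < d) (`|x 0 j - y 0 j| / h).

Definition ginner k h B : {fset 'rV[R]_d} :=
  [fset x in B | [forall y : gboundary h B, k%:R <= gdist h x (val y)]].

(* The value of g at x, and 0 when x lies outside the domain S of g. By
   stencil_in_patch, the default value is never used when x runs over the
   stencils centred in ginner k h B. *)
Definition gval (S : {fset 'rV[R]_d}) (g : {ffun S -> R}) x : R :=
  oapp g 0 (insub x).

Definition cdiff k h B (u : {ffun B -> R}) (j : 'I_d) nu : R :=
  \sum_(m < (2 * k).+1) (-1) ^+ m * 'C(2 * k, m)%:R *
    gval u (nu + ((k%:R - m%:R) * h) *: unitv j).

Definition J k h B (u : {ffun B -> R}) : R :=
  \sum_(nu : ginner k h B) \sum_(j < d) (cdiff k h u j (val nu)) ^+ 2.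

Definition agrees_on X B (f : {ffun X -> R}) (u : {ffun B -> R}) : Prop :=
  forall x : X, gval u (val x) = f x.

Definition is_minimizer k h B X (f : {ffun X -> R}) (u : {ffun B -> R}) : Prop :=
  agrees_on f u /\
  forall u' : {ffun B -> R}, agrees_on f u' -> J k h u <= J k h u'.

Definition unknowns B Y (u : {ffun B -> R}) : 'cV[R]_#|{: Y}| :=
  \col_c gval u (val (enum_val c)).

Notation rows k h B := (ginner k h B * 'I_d)%type.

(* The column of a point y of Y consists of the differences of the grid
   function equal to 1 at y and to 0 elsewhere. *)
Definition lsqA k h B Y : 'M[R]_(#|{: rows k h B}|, #|{: Y}|) :=
  \matrix_(r, c)
    cdiff k h [ffun x : B => (val x == val (enum_val c))%:R]
      (enum_val r).2 (val (enum_val r).1).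

(* The opposite of lsqb consists of the differences of f extended by 0 to B. *)
Definition lsqb k h B X (f : {ffun X -> R}) : 'cV[R]_#|{: rows k h B}| :=
  \col_r - cdiff k h [ffun x : B => gval f (val x)]
             (enum_val r).2 (val (enum_val r).1).

Definition sqnorm n (v : 'cV[R]_n) : R := \sum_(i < n) v i 0 ^+ 2.

Definition posdefmx n (M : 'M[R]_n) : Prop :=
  forall w : 'cV[R]_n, w != 0 -> 0 < (w^T *m M *m w) 0 0.

Lemma gvalE (S : {fset 'rV[R]_d}) (g : {ffun S -> R}) (x : S) :
  gval g (val x) = g x.
Proof. by rewrite /gval valK. Qed.

Lemma gval_out (S : {fset 'rV[R]_d}) (g : {ffun S -> R}) x :
  x \notin S -> gval g x = 0.
Proof. by move=> xS; rewrite /gval insubN. Qed.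

Lemma grid_shift h (z : 'rV[int]_d) (t : int) (j : 'I_d) :
  h *: map_mx intr z + (t%:~R * h) *: unitv j =
  h *: map_mx intr (z + t *: delta_mx 0 j).
Proof.
apply/rowP => i; rewrite !mxE eqxx /= intrD intrM mulrDr; congr (_ + _).
by case: (i == j); rewrite ?mulr0 // mulrAC mulrC mulrA.
Qed.

Lemma gdist_shift k h (z : 'rV[int]_d) (s : int) (j : 'I_d) :
  0 < h -> `|s| < k%:Z ->
  gdist h (h *: map_mx intr z) (h *: map_mx intr (z + s *: delta_mx 0 j))
    < k%:R.
Proof.
move=> h0 sk; have k0 : 0 < k%:R :> R.
  by rewrite ltr0n -ltz_nat (le_lt_trans _ sk).
apply/bigmax_ltP; split=> // i _; rewrite !mxE eqxx /= intrD mulrDr opprD addNKr.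
rewrite normrN normrM (gtr0_norm h0) mulrC mulKf ?lt0r_neq0 //.
rewrite -intr_norm -[k%:R]/(k%:Z%:~R) ltr_int; case: (i == j); rewrite ?mulr1 // mulr0 normr0.
by rewrite (le_lt_trans _ sk).
Qed.

Lemma stencil_in_patch k h B (j : 'I_d) nu (m : 'I_(2 * k).+1) :
  0 < h -> is_grid_patch h B -> nu \in ginner k h B ->
  nu + ((k%:R - m%:R) * h) *: unitv j \in B.
Proof.
move=> h0 [lo [hi BP]]; rewrite !inE => /andP[nuB /forallP nuI].
have [z zlh nuE] := (BP nu).1 nuB; rewrite {}nuE in nuI *.
have memB z' : h *: map_mx intr z' \in B <-> forall j, lo 0 j <= z' 0 j <= hi 0 j.
  split=> [/BP[z'' lh] e|lh]; last by apply/BP; exists z'.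
  suff -> : z' = z'' by [].
  apply/rowP => i; move/rowP/(_ i): e; rewrite !mxE.
  by move/(mulfI (lt0r_neq0 h0))/intr_inj.
set t : int := k%:Z - m%:Z.
have -> : k%:R - m%:R = t%:~R :> R by rewrite /t intrB.
have tk : `|t| <= k%:Z by rewrite /t; have := ltn_ord m; lia.
have far (s : int) : (forall i, lo 0 i <= (z + s *: delta_mx 0 j) 0 i <= hi 0 i) ->
    (z 0 j + s == lo 0 j) || (z 0 j + s == hi 0 j) -> k%:Z <= `|s|.
  move=> inb bd; rewrite leNgt; apply/negP => sk.
  set y := h *: map_mx intr (z + s *: delta_mx 0 j).
  have yB : y \in B by apply/memB.
  have yb : y \in gboundary h B.
    rewrite !inE yB /=; apply/existsP; exists j; rewrite orbC.
    have step (e : int) : y + (e%:~R * h) *: unitv j \in B ->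
        lo 0 j <= z 0 j + s + e <= hi 0 j.
      by rewrite grid_shift => /memB/(_ j); rewrite !mxE !eqxx !mulr1.
    case/orP: bd => /eqP bd; apply/orP; [left|right]; apply/negP => yB'.
      have /andP[] := step (-1) ltac:(by rewrite mulN1r scaleNr).
      by rewrite bd; lia.
    have /andP[_] := step 1 ltac:(by rewrite mul1r).
    by rewrite bd; lia.
  by have := nuI [` yb]; rewrite leNgt gdist_shift.
rewrite grid_shift; apply/memB => i; rewrite !mxE eqxx /=.
have coord (s : int) i' : (z + s *: delta_mx 0 j) 0 i' = z 0 i' + s * (i' == j)%:R.
  by rewrite !mxE eqxx.
have [->|_] := eqVneq i j; last by rewrite mulr0 addr0.
have /andP[zl zh] := zlh j; rewrite mulr1.
have far' (s : int) : lo 0 j <= z 0 j + s <= hi 0 j ->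
    (z 0 j + s == lo 0 j) || (z 0 j + s == hi 0 j) -> k%:Z <= `|s|.
  move=> b1; apply: far => i'; rewrite coord.
  by have [->|_] := eqVneq i' j; rewrite ?mulr1 // mulr0 addr0.
have := far' (lo 0 j - z 0 j); have := far' (hi 0 j - z 0 j).
rewrite !(addrC (z 0 j)) !subrK !eqxx orbT !lexx andbT /= (le_trans zl zh).
move=> /(_ isT isT) kh /(_ isT isT) kl; lia.
Qed.

Lemma lsq_residual k h B X Y (f : {ffun X -> R}) (u : {ffun B -> R})
    (r : 'I_#|{: rows k h B}|) :
  X `|` Y = B -> fdisjoint X Y -> agrees_on f u ->
  (lsqA k h B Y *m unknowns Y u - lsqb k h B f) r 0 =
  cdiff k h u (enum_val r).2 (val (enum_val r).1).
Proof.
move=> XYB dXY fu; rewrite !mxE opprK.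
under eq_bigr do rewrite !mxE /cdiff mulr_suml.
rewrite exchange_big -big_split; apply: eq_bigr => m _ /=.
under eq_bigr do rewrite -(mulrA (_ * _)).
rewrite -mulr_sumr -mulrDr; congr (_ * _).
set x := _ + _ *: _; have [xB|xB] := boolP (x \in B); last first.
  rewrite !(gval_out _ xB) addr0 big1 // => c _.
  by rewrite (gval_out _ xB) mul0r.
have -> (g : {ffun B -> R}) : gval g x = g [` xB] by rewrite -gvalE.
rewrite ffunE /=.
rewrite (eq_bigr (fun c => (x == val (enum_val c))%:R *
    gval u (val (enum_val c)))); last first.
  by move=> c _; rewrite -[x]/(val [` xB]) gvalE ffunE.
rewrite -(big_enum_val (fun y : Y => (x == val y)%:R * gval u (val y))) /=.
have := xB; rewrite -{1}XYB in_fsetU => /orP[xX|xY].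
  rewrite big1 ?add0r => [|y _].
    by rewrite -[x]/(val [` xX]) gvalE -fu /= -[x]/(val [` xB]) gvalE.
  case: eqP => [xy|]; last by rewrite mul0r.
  by move/fdisjointP: dXY => /(_ _ xX); rewrite xy (valP y).
rewrite gval_out ?addr0; last first.
  by apply/negP => xX; move/fdisjointP: dXY => /(_ _ xX); rewrite xY.
rewrite (bigD1 [` xY]) //= eqxx mul1r big1 ?addr0.
  by rewrite -[x]/(val [` xB]) gvalE.
by move=> y yx; rewrite -[x]/(val [` xY]) (inj_eq val_inj) eq_sym (negPf yx) mul0r.
Qed.

Lemma J_lsq k h B X Y (f : {ffun X -> R}) (u : {ffun B -> R}) :
  X `|` Y = B -> fdisjoint X Y -> agrees_on f u ->
  J k h u = sqnorm (lsqA k h B Y *m unknowns Y u - lsqb k h B f).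
Proof.
move=> XYB dXY fu; rewrite /J /sqnorm.
under [RHS]eq_bigr do rewrite (lsq_residual _ XYB dXY fu).
rewrite pair_bigA /=.
rewrite -(big_enum_val (fun p : rows k h B => cdiff k h u p.2 (val p.1) ^+ 2)).
exact: eq_bigl.
Qed.

End Grid.

(* Main.v *)
Require Import Defs.
From mathcomp Require Import all_boot all_order all_algebra.
From mathcomp Require Import finmap.
From mathcomp Require Import reals.
From mathcomp Require Import ring lra.

(** Split into known and unknown values, [J u] is the least-squares functional
    [|A v - b|^2]. A vector in the kernel of [A], extended by 0 to [B], is a grid
    function supported on [Y] whose differences all vanish, so the hypothesis
    says that [A] is injective. Hence [A^T A] is positive definite, the normal
    equations have exactly one solution, and the expansion
    [|A (v + w) - b|^2 = |A v - b|^2 + 2 w^T A^T (A v - b) + |A w|^2] shows that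
    the minimizers are the solutions of the normal equations. *)

Set Implicit Arguments.
Unset Strict Implicit.
Unset Printing Implicit Defensive.

Import Order.TTheory GRing.Theory Num.Theory.

Local Open Scope fset_scope.
Local Open Scope ring_scope.

Section LeastSquares.
Variables (R : realType) (m n : nat) (A : 'M[R]_(m, n)) (b : 'cV[R]_m).
Implicit Types (v w : 'cV[R]_n).

Lemma sqnormE p (x : 'cV[R]_p) : sqnorm x = (x^T *m x) 0 0.
Proof. by rewrite !mxE; apply: eq_bigr => i _; rewrite !mxE expr2. Qed.

Lemma sqnorm_ge0 p (x : 'cV[R]_p) : 0 <= sqnorm x.
Proof. by apply: sumr_ge0 => i _; rewrite sqr_ge0. Qed.

Lemma sqnorm_eq0 p (x : 'cV[R]_p) : (sqnorm x == 0) = (x == 0).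
Proof.
rewrite /sqnorm psumr_eq0 => [|i _]; last exact: sqr_ge0.
apply/allP/eqP => [x0|-> i _]; last by rewrite mxE expr0n /=.
apply/colP => i; rewrite mxE; apply/eqP.
by rewrite -sqrf_eq0; apply: x0; rewrite mem_index_enum.
Qed.

(** Moving [A^T] across the product turns the cross term into $(Aw)^T(Av-b)$, so the expansion is
    that of a square in each entry. *)
Lemma sqnorm_residualD v w :
  sqnorm (A *m (v + w) - b) =
  sqnorm (A *m v - b) + (w^T *m (A^T *m (A *m v - b))) 0 0 *+ 2 +
  sqnorm (A *m w).
Proof.
rewrite (mulmxDr A) [in LHS]addrAC mulmxA -trmx_mul.
set r := A *m v - b; set s := A *m w; rewrite !mxE /sqnorm -sumrMnl -!big_split /=.
by apply: eq_bigr => i _; rewrite !mxE; ring.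
Qed.

Lemma normal_equationsP v :
  (forall w, sqnorm (A *m v - b) <= sqnorm (A *m w - b)) <->
  A^T *m A *m v = A^T *m b.
Proof.
split=> [vmin|nrm w]; last first.
  rewrite -(subrKC v w) sqnorm_residualD (mulmxBr A^T) (mulmxA A^T) nrm subrr.
  by rewrite mulmx0 mxE mul0rn addr0 lerDl sqnorm_ge0.
(* [g] is half the gradient of the functional at [v]; if it were nonzero, a suitable step along
   [- g] would go below the minimum. *)
apply/eqP; rewrite -subr_eq0 -mulmxA -mulmxBr; set g := A^T *m _.
rewrite -sqnorm_eq0 eq_le sqnorm_ge0 andbT leNgt; apply/negP => g_gt0.
have c_ge0 := sqnorm_ge0 (A *m g).
set c := sqnorm (A *m g) in c_ge0; set a := sqnorm g in g_gt0.
(* A step along [- g] of length [t] changes the value by [t * (t * c - 2 * a)]. *)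
pose t := a / (c + 1); have t_gt0 : 0 < t by rewrite divr_gt0 // ltr_wpDl.
(* The 1 added to [c] keeps the denominator positive even when [A *m g = 0]. By this identity the
   change is [- t * (a + t) < 0]. *)
have tE : t * c = a - t by rewrite /t; field; rewrite gt_eqF // ltr_wpDl.
have := vmin (v + (- t) *: g); apply/negP; rewrite -ltNge sqnorm_residualD -/g.
have -> : ((- t *: g)^T *m g) 0 0 = - t * a.
  by rewrite linearZ -scalemxAl mxE /a sqnormE.
have -> : sqnorm (A *m (- t *: g)) = t * (t * c).
  rewrite -scalemxAr /c /sqnorm !mulr_sumr; apply: eq_bigr => i _.
  by rewrite mxE; ring.
rewrite tE; nra.
Qed.

Hypothesis A_inj : forall w, A *m w = 0 -> w = 0.

Lemma gram_posdef : posdefmx (A^T *m A).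
Proof.
move=> w w0; rewrite mulmxA -trmx_mul -mulmxA -sqnormE lt_def sqnorm_ge0 andbT.
by rewrite sqnorm_eq0; apply: contra w0 => /eqP/A_inj ->.
Qed.

(** A row [w] killed by [A^T *m A] satisfies $|A w^T|^2 = w A^T A w^T = 0$, and [A] is injective. *)
Lemma gram_unit : A^T *m A \in unitmx.
Proof.
rewrite -row_free_unit; apply: inj_row_free => w w0; apply: trmx_inj.
rewrite trmx0; apply: A_inj; apply/eqP; rewrite -sqnorm_eq0 sqnormE.
by rewrite trmx_mul trmxK mulmxA -(mulmxA w) w0 mul0mx mxE.
Qed.

End LeastSquares.

Lemma gval0 (R : realType) d (S : {fset 'rV[R]_d}) x :
  gval (0 : {ffun S -> R}) x = 0.
Proof. by rewrite /gval; case: insubP => //= y _ _; rewrite ffunE. Qed.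

Section Fill.
Variables (R : realType) (d : nat) (B X Y : {fset 'rV[R]_d}).
Hypotheses (XYB : X `|` Y = B) (dXY : fdisjoint X Y).

(** For fixed [f], this is the inverse of [unknowns Y] on the grid functions that agree with [f]. *)
Definition fill (f : {ffun X -> R}) (v : 'cV[R]_#|{: Y}|) : {ffun B -> R} :=
  [ffun x => oapp (fun y => v (enum_rank y) 0) (gval f (val x))
               (insub (val x))].

Lemma fill_agrees f v : agrees_on f (fill f v).
Proof.
move=> x; have xB : val x \in B by rewrite -XYB in_fsetU (valP x).
rewrite -[val x]/(val [` xB]) gvalE ffunE insubN /= ?gvalE //.
by move/fdisjointP: dXY; apply; apply: valP.
Qed.

Lemma fill_unknowns f v : unknowns Y (fill f v) = v.
Proof.
apply/colP => c; rewrite mxE; set y := enum_val c.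
have yB : val y \in B by rewrite -XYB in_fsetU (valP y) orbT.
by rewrite -[val y]/(val [` yB]) gvalE ffunE /= valK /= enum_valK.
Qed.

Lemma unknowns_inj (f : {ffun X -> R}) (u u' : {ffun B -> R}) :
  agrees_on f u -> agrees_on f u' -> unknowns Y u = unknowns Y u' -> u = u'.
Proof.
move=> fu fu' /colP uu'; apply/ffunP => x; rewrite -!gvalE.
have : val x \in X `|` Y by rewrite XYB (valP x).
rewrite in_fsetU => /orP[xX|xY].
  by have := fu [` xX]; rewrite -fu'.
by have := uu' (enum_rank [` xY]); rewrite !mxE enum_rankK.
Qed.

Lemma lsqb0 k h : lsqb k h B (0 : {ffun X -> R}) = 0.
Proof.
apply/colP => r; rewrite !mxE /cdiff big1 ?oppr0 // => i _.
rewrite [X in gval X _](_ : _ = 0) ?gval0 ?mulr0 //.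
by apply/ffunP => x; rewrite !ffunE gval0.
Qed.

Lemma lsqA_inj k h :
  (forall w : {ffun B -> R},
     (forall x : B, val x \notin Y -> w x = 0) ->
     (forall nu, nu \in ginner k h B -> forall j, cdiff k h w j nu = 0) ->
     forall x : B, w x = 0) ->
  forall w : 'cV_#|{: Y}|, lsqA k h B Y *m w = 0 -> w = 0.
Proof.
move=> ker w Aw; pose u := fill 0 w; have u0 : agrees_on 0 u := fill_agrees _ _.
have {}ker : u = 0.
  apply/ffunP => x; rewrite [RHS]ffunE; move: x; apply: ker => [x xY|nu nuI j].
    by rewrite ffunE insubN //= gval0.
  (* With zero known values [b] vanishes, so the entry of [A w] at [(nu, j)] is the difference of
     [u] itself. *)
  have := lsq_residual (enum_rank ([` nuI], j)) XYB dXY u0.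
  by rewrite enum_rankK fill_unknowns Aw lsqb0 subr0 mxE => /esym.
rewrite -(fill_unknowns 0 w) -/u ker; by apply/colP => c; rewrite !mxE gval0.
Qed.

(** Every vector is the vector of unknowns of an admissible grid function, so minimizing over grid
    functions amounts to minimizing over all vectors. *)
Lemma is_minimizerP k h (f : {ffun X -> R}) (u : {ffun B -> R}) : agrees_on f u ->
  is_minimizer k h f u <->
  (lsqA k h B Y)^T *m lsqA k h B Y *m unknowns Y u =
  (lsqA k h B Y)^T *m lsqb k h B f.
Proof.
move=> fu; rewrite -normal_equationsP; split=> [[_ umin] w|umin].
  rewrite -(J_lsq k h XYB dXY fu) -(fill_unknowns f w).
  by rewrite -(J_lsq k h XYB dXY (fill_agrees f w)); apply/umin/fill_agrees.
split=> // u' fu'.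
by rewrite (J_lsq k h XYB dXY fu) (J_lsq k h XYB dXY fu').
Qed.

End Fill.

Theorem theorem4p2 (R : realType) (d k : nat) (h : R)
    (B X Y : {fset 'rV[R]_d}) (f : {ffun X -> R}) :
  (1 <= d)%N -> (1 <= k)%N -> 0 < h ->
  is_grid_patch h B ->
  X `|` Y = B -> fdisjoint X Y ->
  Y `<` B -> Y `<=` ginner k h B ->
  (forall w : {ffun B -> R},
     (forall x : B, val x \notin Y -> w x = 0) ->
     (forall nu : 'rV[R]_d, nu \in ginner k h B ->
        forall j : 'I_d, cdiff k h w j nu = 0) ->
     forall x : B, w x = 0) ->
  (exists! u : {ffun B -> R}, is_minimizer k h f u) /\
  let A := lsqA k h B Y in
  let b := lsqb k h B f in
  [/\ (A^T *m A)^T = A^T *m A,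
      posdefmx (A^T *m A) &
      forall u : {ffun B -> R}, agrees_on f u ->
        is_minimizer k h f u <-> A^T *m A *m unknowns Y u = A^T *m b].
Proof.
move=> _ _ _ _ XYB dXY _ _ ker; have Ainj := lsqA_inj XYB dXY ker.
have minP u := @is_minimizerP R d B X Y XYB dXY k h f u.
have Gunit := gram_unit Ainj; split; last first.
  by split=> [||u /minP //]; [rewrite trmx_mul trmxK | apply: gram_posdef].
pose A := lsqA k h B Y; pose b := lsqb k h B f.
pose v := invmx (A^T *m A) *m (A^T *m b).
have fv : agrees_on f (fill B f v) by apply: fill_agrees.
exists (fill B f v); split.
  by apply/minP => //; rewrite fill_unknowns // mulKVmx.
(* Any minimizer solves the same normal equations, so its unknowns are [v]; its other values are
   those of [f]. *)
move=> u umin; have fu := umin.1; apply: (unknowns_inj XYB fv fu).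
by rewrite fill_unknowns // /v; move/minP: umin => <- //; rewrite mulKmx.
Qed.
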